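(* Every graph on at most four vertices has property ( * ).
   Context: All graphs are finite, undirected, and simple. An anticlique is a set of pairwise nonadjacent vertices. A coloring of a graph $G$ is a partition $\mathfrak{C}$ of $V(G)$ into anticliques (nonempty, called color classes). A transversal of $\mathfrak{C}$ is a set $T$ containing exactly one element of each member of $\mathfrak{C}$ and nothing else. A Kempe chain is a connected component of $G[A\cup B]$ for some $A\neq B$ from $\mathfrak{C}$. The routing graph $H(G,\mathfrak{C},T)$ is the graph on vertex set $T$ in which two distinct $s,t\in T$ are adjacent if and only if they belong to the same Kempe chain in $G$ (equivalently, there is an $s$,$t$-path in $G[A\cup B]$ where $A,B\in\mathfrak{C}$ are the classes containing $s,t$). For a graph $H$ with $V(H)\subseteq V(G)$, a rooted $H$-certificate in $G$ is a family $(V_t)_{t\in V(H)}$ of pairwise disjoint subsets of $V(G)$ (bags) such that $t\in V_t$ and $G[V_t]$ is connected for all $t\in V(H)$, and for every $st\in E(H)$ there is an edge of $G$ connecting $V_s$ and $V_t$. A graph $K$ has property ( * ) if for every graph $G$, every coloring $\mathfrak{C}$ of $G$ with $|\mathfrak{C}|=|V(K)|$, every transversal $T$ of $\mathfrak{C}$, and every spanning subgraph $H$ of $H(G,\mathfrak{C},T)$ isomorphic to $K$, there exists a rooted $H$-certificate in $G$. *)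

(* Defs.v *)
From mathcomp Require Import all_boot.

Set Implicit Arguments.
Unset Strict Implicit.
Unset Printing Implicit Defensive.

Record graph (V : finType) := Graph {
  adj :> rel V;
  adj_sym : symmetric adj;
  adj_irrefl : irreflexive adj
}.

Section Graphs.

Variables (V : finType) (G : graph V).
Implicit Types (S T X : {set V}) (C : {set {set V}}).

Definition anticlique S : bool := [forall x in S, forall y in S, ~~ adj G x y].

(* The edge relation of G[S], kept on V: vertices outside S become isolated,
   so [connect (induced S)] is only meaningful between elements of S. *)
Definition induced S : rel V := [rel x y | [&& x \in S, y \in S & adj G x y]].

Definition connected_in S : Prop :=
  forall x y, x \in S -> y \in S -> connect (induced S) x y.

Definition components S : {set {set V}} :=
  equivalence_partition (connect (induced S)) S.

(* [partition] already requires the classes to be nonempty. *)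
Definition coloring C : bool :=
  partition C [set: V] && [forall A in C, anticlique A].

Definition transversal_of C T : bool := is_transversal T C [set: V].

Definition kempe_chain C X : bool :=
  [exists A in C, exists B in C, (A != B) && (X \in components (A :|: B))].

Definition routing_adj C T : rel {x : V | x \in T} :=
  [rel s t | (s != t) &&
    [exists X : {set V}, [&& kempe_chain C X, val s \in X & val t \in X]]].

Lemma routing_adj_sym C T : symmetric (@routing_adj C T).
Proof.
by move=> s t; rewrite /routing_adj /= eq_sym; congr (_ && _);
  apply: eq_existsb => X; rewrite [(val s \in X) && _]andbC.
Qed.

Lemma routing_adj_irrefl C T : irreflexive (@routing_adj C T).
Proof. by move=> s; rewrite /routing_adj /= eqxx. Qed.

Definition routing_graph C T : graph {x : V | x \in T} :=
  Graph (@routing_adj_sym C T) (@routing_adj_irrefl C T).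

(* A graph with vertex set T, a subset of the vertices of G, is a graph on the
   subtype of elements of T. *)
Definition rooted_certificate T (H : graph {x : V | x \in T})
    (bag : {x : V | x \in T} -> {set V}) : Prop :=
  [/\ forall s t, s != t -> [disjoint bag s & bag t],
      forall t, val t \in bag t,
      forall t, connected_in (bag t) &
      forall s t, adj H s t ->
        exists x y, [/\ x \in bag s, y \in bag t & adj G x y]].

End Graphs.

Definition spanning_subgraph (V : finType) (H G : graph V) : Prop :=
  forall x y, adj H x y -> adj G x y.

Definition isomorphic (V W : finType) (G : graph V) (H : graph W) : Prop :=
  exists2 f : V -> W, bijective f & forall x y, adj H (f x) (f y) = adj G x y.

Definition property_star (W : finType) (K : graph W) : Prop :=
  forall (V : finType) (G : graph V) (C : {set {set V}}) (T : {set V})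
         (H : graph {x : V | x \in T}),
    coloring G C -> #|C| = #|W| -> transversal_of C T ->
    spanning_subgraph H (routing_graph G C T) -> isomorphic H K ->
    exists bag : {x : V | x \in T} -> {set V}, rooted_certificate G H bag.

(* Main.v *)
Require Import Defs.
From mathcomp Require Import all_boot.

(* The statement for K_4 with every pair of roots joined by a Kempe chain is
   enough: a pair of roots that need not be linked is joined by a new edge,
   which no bag can use, and missing colours are padded with isolated roots.
   For K_4, induct on the number of edges, dropping the requirement that the
   colouring be proper: if some edge is monochromatic, contract it.
   Recolouring therefore gives two facts, since otherwise a monochromatic edge
   appears.  (1) A set Z containing exactly one root has at least three
   neighbours: with at most two, the linking paths that do not end in Z can
   avoid it, so Z could take the colour of its root.  (2) If u is a neighbour
   of the root i that has the colour j and is not the root j, then u lies on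
   the path P_jk or P_jl.
   Unless all roots are adjacent, counting (2) over the three ways to pair up
   the roots gives a pairing ij|kl for which i and j have neighbours on P_kl
   other than the root k, and k has a neighbour w inside P_ij.  The bags of k
   and l are mostly two halves of P_kl, and those of i and j come from the two
   parts of P_ij - w; by (1) each of these parts, enlarged to a component,
   attaches to P_kl in two places or reaches the other part. *)

Set Implicit Arguments.
Unset Strict Implicit.
Unset Printing Implicit Defensive.

(** * Connected sets, components and neighbourhoods *)

Section Connectivity.

Variables (V : finType) (e : rel V).
Hypothesis e_sym : symmetric e.
Implicit Types (S A B : {set V}) (x y z : V).

(** Stated for a bare relation, unlike [induced], because contracting and adding edges will produce
    relations rather than [graph] records. *)
Definition within S : rel V := [rel x y | [&& x \in S, y \in S & e x y]].

Definition conn S : Prop := {in S &, forall x y, connect (within S) x y}.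

Definition touch A B : bool := [exists x in A, exists y in B, e x y].

Definition nbhd S : {set V} := [set y | (y \notin S) && [exists x in S, e x y]].

Definition comp S x : {set V} := [set z | connect (within S) x z].

Lemma touchP A B :
  reflect (exists x y, [/\ x \in A, y \in B & e x y]) (touch A B).
Proof.
apply: (iffP exists_inP) => [[x xA /exists_inP[y yB xy]]|[x [y [xA yB xy]]]].
  by exists x, y.
by exists x => //; apply/exists_inP; exists y.
Qed.

Lemma touch_sym A B : touch A B = touch B A.
Proof.
by apply/touchP/touchP => -[x [y [xA yB xy]]]; exists y, x;
  split=> //; rewrite e_sym.
Qed.

Lemma touch_sub A A' B B' :
  A \subset A' -> B \subset B' -> touch A B -> touch A' B'.
Proof.
move=> /subsetP sA /subsetP sB /touchP[x [y [xA yB xy]]].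
by apply/touchP; exists x, y; split; [apply: sA | apply: sB |].
Qed.

Lemma within_sym S : connect_sym (within S).
Proof. by apply: sym_connect_sym => x y; rewrite /within /= e_sym andbCA. Qed.

Lemma connect_cut (r : rel V) A x y :
  connect r x y -> x \in A -> y \notin A ->
  exists a b, [/\ a \in A, b \notin A & r a b].
Proof.
case/connectP=> p; elim: p x => [|z p IHp] x /=; first by move=> _ -> ->.
case/andP=> xz zp Ey xA yA.
have [zA|zA] := boolP (z \in A); first exact: IHp zp Ey zA yA.
by exists x, z.
Qed.

Lemma conn_star S x : {in S, forall z, connect (within S) x z} -> conn S.
Proof.
move=> xS y z yS zS; apply: connect_trans (xS z zS).
by rewrite within_sym xS.
Qed.

Lemma within_path S x p :
  {subset x :: p <= S} -> path e x p -> path (within S) x p.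
Proof.
move=> sub xp; have eS : {in S &, subrel e (within S)}.
  by move=> y z yS zS yz; rewrite /within /= yS zS.
by apply: (sub_in_path eS) xp; apply/allP => y /sub.
Qed.

Lemma conn_path x p : path e x p -> conn [set z in x :: p].
Proof.
move=> xp; apply: (@conn_star _ x) => z; rewrite in_set => zp.
have sub : {subset x :: p <= [set z in x :: p]} by move=> y yp; rewrite inE.
exact: (path_connect (within_path sub xp) zp).
Qed.

Lemma conn1 x : conn [set x].
Proof. by move=> y z /set1P-> /set1P->; apply: connect0. Qed.

Lemma within_mono S S' : S \subset S' -> subrel (connect (within S)) (connect (within S')).
Proof.
move=> /subsetP sS; apply: connect_sub => x y /and3P[xS yS xy].
by apply: connect1; rewrite /within /= !sS.
Qed.

Lemma conn_add S x y : conn S -> x \in S -> e x y -> conn (y |: S).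
Proof.
move=> cS xS xy; apply: (@conn_star _ x) => z; rewrite inE => /orP[/set1P->|zS].
  by apply: connect1; rewrite /within /= !inE xS eqxx orbT.
by apply: (within_mono (subsetUr _ _)); apply: cS.
Qed.

Lemma mem_comp S x : x \in comp S x.
Proof. by rewrite inE connect0. Qed.

Lemma comp_sub S x : x \in S -> comp S x \subset S.
Proof.
move=> xS; apply/subsetP=> z; rewrite inE => xz.
have [//|zS] := boolP (z \in S).
have [a [b [_ bS /and3P[_ bS' _]]]] := connect_cut xz xS zS.
by rewrite bS' in bS.
Qed.

Lemma comp_closed S x a b :
  x \in S -> a \in comp S x -> b \in S -> e a b -> b \in comp S x.
Proof.
move=> xS aC bS ab; have aS := subsetP (comp_sub xS) _ aC.
move: aC; rewrite !inE => /connect_trans; apply; apply: connect1.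
by rewrite /within /= aS bS.
Qed.

Lemma comp_conn S x : conn (comp S x).
Proof.
apply: (@conn_star _ x) => z; rewrite inE => /connectP[p xp ->].
have xpe : path e x p by apply: sub_path xp => u v /and3P[].
have sub : {subset x :: p <= comp S x}.
  by move=> y yp; rewrite inE (path_connect xp).
exact: (path_connect (within_path sub xpe) (mem_last _ _)).
Qed.

Lemma path_comp S x p :
  {subset x :: p <= S} -> path e x p -> {subset x :: p <= comp S x}.
Proof.
by move=> sub xp y yp; rewrite inE (path_connect (within_path sub xp)).
Qed.

Lemma nbhd_comp S x y : x \in S -> y \in nbhd (comp S x) -> y \notin S.
Proof.
move=> xS; rewrite inE => /andP[yC /exists_inP[a aC ay]].
by apply: contra yC => yS; apply: comp_closed ay.
Qed.

End Connectivity.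

(** * Four bags from two disjoint paths *)

Section FourBags.

Variables (V : finType) (e : rel V).
Hypothesis e_sym : symmetric e.
Implicit Types (S A B C D : {set V}) (a b u v w x y z : V).

Definition bagged_K4 a b u v : Prop := exists A B C D,
  [/\ [/\ a \in A, b \in B, u \in C & v \in D],
      [/\ conn e A, conn e B, conn e C & conn e D],
      [/\ [disjoint A & B], [disjoint A & C] & [disjoint A & D]],
      [/\ [disjoint B & C], [disjoint B & D] & [disjoint C & D]] &
      [/\ touch e A B, touch e A C, touch e A D &
          [/\ touch e B C, touch e B D & touch e C D]]].

Lemma bagged_K4_swap a b u v : bagged_K4 a b u v -> bagged_K4 b a u v.
Proof.
case=> A [B [C [D [[aA bB uC vD] [cA cB cC cD] [AB AC AD] [BC BD CD]]]]].
case=> tAB tAC tAD [tBC tBD tCD].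
exists B, A, C, D; split=> //; first by split=> //; rewrite disjoint_sym.
by split=> //; rewrite touch_sym.
Qed.

Lemma disjoint_in (A B : {pred V}) :
  {in A, forall z, z \notin B} -> [disjoint A & B].
Proof. by move=> AB; rewrite disjoint_subset; apply/subsetP. Qed.

Lemma split_path u q t : path e u q -> 0 < t <= size q ->
  exists q1 x q2, [/\ take t (u :: q) = u :: q1, drop t (u :: q) = x :: q2,
    path e u q1, e (last u q1) x & path e x q2].
Proof.
case: t => // t uq /= tq.
have Eq := cat_take_drop t q; rewrite (drop_nth u tq) in Eq.
exists (take t q), (nth u q t), (drop t.+1 q); rewrite (drop_nth u tq).
by move: uq; rewrite -{1}Eq cat_path /= => /and3P[].
Qed.

(* Cutting u :: q just before the first of d1 and d2 leaves c2 in the first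
   half; w joins the bag of a to u. *)
Lemma K4_of_columns a b u v q w Z1 Z2 d1 c2 d2 :
  let s := u :: q in
  path e u q -> last u q = v -> uniq s ->
  conn e Z1 -> conn e Z2 -> a \in Z1 -> b \in Z2 -> [disjoint Z1 & Z2] ->
  w \notin s -> w \notin Z2 -> e u w ->
  {in s, forall z, z \notin Z1} -> {in s, forall z, z \notin Z2} ->
  touch e [set w] Z1 -> touch e [set w] Z2 ->
  d1 \in s -> c2 \in s -> d2 \in s ->
  touch e Z1 [set d1] -> touch e Z2 [set c2] -> touch e Z2 [set d2] ->
  index c2 s < index d1 s -> index c2 s < index d2 s ->
  bagged_K4 a b u v.
Proof.
move=> s uq Ev us cZ1 cZ2 aZ1 bZ2 dZ ws wZ2 uw sZ1 sZ2 tw1 tw2 d1s c2s d2s.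
move=> td1 tc2 td2 lt1 lt2.
set t := minn (index d1 s) (index d2 s).
have c2t : index c2 s < t by rewrite leq_min lt1.
have t_gt0 : 0 < t by apply: leq_ltn_trans c2t.
have tq : t <= size q.
  by rewrite geq_min -ltnS -[(size q).+1]/(size s) index_mem d1s.
have t_bounds : 0 < t <= size q by rewrite t_gt0.
have [q1 [x [q2 [Etake Edrop uq1 q1x xq2]]]] := split_path uq t_bounds.
have Es := cat_take_drop t s.
have memD z : z \in s -> t <= index z s -> z \in drop t s.
  move=> zs; rewrite leqNgt -in_take // => zC.
  by move: zs; rewrite -{1}Es mem_cat (negPf zC).
have [z1 z1Z z1w] : exists2 z, z \in Z1 & e z w.
  by case/touchP: tw1 => _ [z [/set1P-> zZ wz]]; exists z; rewrite // e_sym.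
have uC : u \in take t s by rewrite Etake mem_head.
have vD : v \in drop t s.
  rewrite Edrop -Ev; suff -> : last u q = last x q2 by apply: mem_last.
  by have := congr1 (last u) Es; rewrite Etake Edrop last_cat /= => <-.
exists (w |: Z1), Z2, [set z in take t s], [set z in drop t s].
split.
- by rewrite !inE aZ1 orbT bZ2 uC vD.
- split=> //; first exact: conn_add z1w.
    by rewrite Etake; apply: conn_path.
  by rewrite Edrop; apply: conn_path.
- split; apply: disjoint_in => z.
  + by case/setU1P=> [-> //|zZ]; rewrite (disjointFr dZ zZ).
  + case/setU1P=> [->|zZ]; rewrite inE.
      by apply: contra ws; apply: mem_take.
    by apply: contraL zZ => /mem_take/sZ1.
  + case/setU1P=> [->|zZ]; rewrite inE.
      by apply: contra ws; apply: mem_drop.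
    by apply: contraL zZ => /mem_drop/sZ1.
- split; apply: disjoint_in => z.
  + by move=> zZ; rewrite inE; apply: contraL zZ => /mem_take/sZ2.
  + by move=> zZ; rewrite inE; apply: contraL zZ => /mem_drop/sZ2.
  + rewrite !inE => zC; apply/negP=> zD.
    move: us; rewrite -Es cat_uniq => /and3P[_ /hasP[]].
    by exists z.
- have sub1 : Z1 \subset w |: Z1 by apply: subsetUr.
  have subw : [set w] \subset w |: Z1 by apply: subsetUl.
  split; last split.
  + exact: touch_sub tw2.
  + by apply/touchP; exists w, u; rewrite !inE eqxx uC e_sym.
  + apply: (touch_sub sub1 _ td1); rewrite sub1set inE memD //.
    exact: geq_minl.
  + apply: (touch_sub (subxx _) _ tc2); rewrite sub1set inE in_take //.
  + apply: (touch_sub (subxx _) _ td2); rewrite sub1set inE memD //.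
    exact: geq_minr.
  + apply/touchP; exists (last u q1), x.
    by rewrite !inE Etake Edrop mem_last mem_head.
Qed.

(** [Z] is the component of [a] after deleting [w], the path from [b] and the column [u :: q]. If it
    touches the path from [b], the bags are [Z], that path, [{w, u}] and [q]: both paths end next to
    [w], and [c], [d] link them to [q]. Otherwise only [w] and the column can border [Z]. *)
Lemma rerouted_K4_or_separation a p1 b p2 w u q v c d :
  path e a p1 -> e (last a p1) w -> path e b p2 -> e (last b p2) w ->
  {in a :: p1, forall z, z \notin b :: p2} ->
  w \notin a :: p1 -> w \notin b :: p2 ->
  path e u q -> last u q = v -> uniq (u :: q) -> w \notin u :: q ->
  {in a :: p1, forall z, z \notin u :: q} ->
  {in b :: p2, forall z, z \notin u :: q} ->
  e u w -> c \in q -> e a c -> d \in q -> e b d ->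
  bagged_K4 a b u v \/
  exists Z, [/\ conn e Z, {subset a :: p1 <= Z},
    {in b :: p2, forall z, z \notin Z}, {in w :: u :: q, forall z, z \notin Z} &
    nbhd e Z \subset [set z in w :: u :: q]].
Proof.
move=> ap1 p1w bp2 p2w dis12 w1 w2 uq Ev us ws dis1 dis2 uw cq ac dq bd.
pose S := [set z | [&& z != w, z \notin b :: p2 & z \notin u :: q]].
have subS : {subset a :: p1 <= S}.
  move=> z zp; rewrite inE dis12 // dis1 // !andbT.
  by apply: contraNneq w1 => <-.
have aS : a \in S by apply/subS/mem_head.
have subZ := path_comp subS ap1.
have ZS : {subset comp e S a <= S} by apply/subsetP/comp_sub.
have cZ : conn e (comp e S a) by apply: comp_conn.
have [tZ|tZ] := boolP (touch e (comp e S a) [set z in b :: p2]); [left | right].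
  (* Since [q] contains [c], it has a first vertex [x], whose edge to [u] links the last two
     bags. *)
  case: q => [//|x q] in uq Ev us ws dis1 dis2 cq dq S subS aS subZ ZS cZ tZ *.
  have /= /andP[ux xq] := uq.
  exists (comp e S a), [set z in b :: p2], (w |: [set u]), [set z in x :: q].
  split.
  - rewrite mem_comp [b \in _]inE mem_head [v \in _]inE -Ev /= mem_last.
    by split=> //; rewrite !inE eqxx orbT.
  - split=> //; try exact: conn_path.
    by apply: (conn_add e_sym _ _ uw); [exact: conn1 | rewrite inE].
  - split; apply: disjoint_in => z /ZS; rewrite !inE.
    + by case/and3P.
    + by case/and3P=> /negPf-> _; rewrite negb_or => /andP[].
    + by case/and3P=> _ _; rewrite negb_or => /andP[].
  - split; apply: disjoint_in => z.
    + rewrite inE => zp; rewrite !inE negb_or.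
      have := dis2 z zp; rewrite inE negb_or => /andP[-> _].
      by rewrite andbT; apply: contraNneq w2 => <-.
    + by rewrite !inE => zp; have := dis2 z zp; rewrite !inE negb_or => /andP[].
    + rewrite !inE => /orP[/eqP->|/eqP->].
        by move: ws; rewrite !inE negb_or => /andP[].
      by move: us; rewrite /= inE => /andP[].
  - split=> //; last split.
    + apply/touchP; exists (last a p1), w; split=> //.
        exact/subZ/mem_last.
      by rewrite !inE eqxx.
    + by apply/touchP; exists a, c; rewrite mem_comp in_set cq.
    + apply/touchP; exists (last b p2), w; split=> //.
        by rewrite in_set mem_last.
      by rewrite !inE eqxx.
    + by apply/touchP; exists b, d; rewrite !in_set mem_head dq.
    + by apply/touchP; exists u, x; rewrite !inE !eqxx orbT.
exists (comp e S a); split=> //.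
- by move=> z zp; apply/negP=> /ZS; rewrite inE zp andbF.
- move=> z zq; apply/negP=> /ZS; rewrite inE; case/and3P=> zw _.
  by apply/negP; rewrite negbK; move: zq; rewrite inE (negPf zw).
apply/subsetP=> z zN; have := nbhd_comp aS zN; rewrite !inE !negb_and !negbK.
have [-> //|_ /=] := eqVneq z w; case/orP=> // zp.
case/negP: tZ; move: zN; rewrite inE => /andP[_ /exists_inP[y yZ yz]].
by apply/touchP; exists y, z; rewrite inE.
Qed.

(** At most one of three neighbours is [w]; two others lie on [s] and are named in order of
    position. *)
Lemma two_columns Z w s :
  2 < #|nbhd e Z| -> nbhd e Z \subset [set z in w :: s] ->
  exists c d, [/\ c \in s, d \in s, touch e Z [set c], touch e Z [set d] &
    index c s < index d s].
Proof.
move=> N3 /subsetP Nsub.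
have /card_gt1P[c [d [cN dN cd]]] : 1 < #|nbhd e Z :\ w|.
  by move: N3; rewrite (cardsD1 w); case: (w \in _) => // /ltnW.
have colP x : x \in nbhd e Z :\ w -> x \in s /\ touch e Z [set x].
  case/setD1P=> xw xN; have := Nsub _ xN; rewrite !inE (negPf xw) /= => xs.
  split=> //; move: xN; rewrite inE => /andP[_ /exists_inP[y yZ yx]].
  by apply/touchP; exists y, x; rewrite inE eqxx.
have [[cs tc] [ds td]] := (colP c cN, colP d dN).
case: (ltngtP (index c s) (index d s)) => [lt|lt|Ei].
- by exists c, d.
- by exists d, c.
- by move: cd; rewrite -(nth_index c cs) Ei nth_index // eqxx.
Qed.

(** The rerouting lemma is applied from both ends of the first path. If neither use yields the bags,
    [a] and [b] get sets [Z1] and [Z2] that each attach to the column in two places, and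
    [K4_of_columns] finishes. *)
Lemma crossing_paths_K4 a p1 b p2 w u q v c d :
  path e a p1 -> e (last a p1) w -> path e b p2 -> e (last b p2) w ->
  {in a :: p1, forall z, z \notin b :: p2} ->
  w \notin a :: p1 -> w \notin b :: p2 ->
  path e u q -> last u q = v -> uniq (u :: q) -> w \notin u :: q ->
  {in a :: p1, forall z, z \notin u :: q} ->
  {in b :: p2, forall z, z \notin u :: q} ->
  e u w -> c \in q -> e a c -> d \in q -> e b d ->
  (forall Z, conn e Z -> a \in Z -> b \notin Z -> u \notin Z -> v \notin Z ->
    2 < #|nbhd e Z|) ->
  (forall Z, conn e Z -> b \in Z -> a \notin Z -> u \notin Z -> v \notin Z ->
    2 < #|nbhd e Z|) ->
  bagged_K4 a b u v.
Proof.
move=> ap1 p1w bp2 p2w dis12 w1 w2 uq Ev us ws dis1 dis2 uw cq ac dq bd Na Nb.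
have dis21 : {in b :: p2, forall z, z \notin a :: p1}.
  by move=> z zp2; apply/negP=> /dis12; rewrite zp2.
have [//|[Z1 [cZ1 p1Z1 p2Z1 sZ1 NZ1]]] := rerouted_K4_or_separation ap1 p1w bp2
  p2w dis12 w1 w2 uq Ev us ws dis1 dis2 uw cq ac dq bd.
have [/bagged_K4_swap//|[Z2 [cZ2 p2Z2 p1Z2 sZ2 NZ2]]] := rerouted_K4_or_separation
  bp2 p2w ap1 p1w dis21 w2 w1 uq Ev us ws dis2 dis1 uw dq bd cq ac.
have aZ1 := p1Z1 a (mem_head _ _); have bZ2 := p2Z2 b (mem_head _ _).
have bZ1 := p2Z1 b (mem_head _ _); have aZ2 := p1Z2 a (mem_head _ _).
have u_s : u \in w :: u :: q by rewrite !inE eqxx orbT.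
have v_s : v \in w :: u :: q by rewrite inE -Ev mem_last orbT.
have w_s : w \in w :: u :: q by apply: mem_head.
(* [Z2] is connected and avoids every neighbour of [Z1]; if it met [Z1] it would lie inside [Z1],
   which misses [b]. *)
have dZ : [disjoint Z1 & Z2].
  apply: disjoint_in => x xZ1; apply/negP=> xZ2.
  have [y [z [yZ1 zZ1 /and3P[yZ2 zZ2 yz]]]] := connect_cut (cZ2 _ _ xZ2 bZ2) xZ1 bZ1.
  have : z \in nbhd e Z1 by rewrite inE zZ1; apply/exists_inP; exists y.
  by move/(subsetP NZ1); rewrite inE => /sZ2; rewrite zZ2.
have [c1 [d1 [c1s d1s tc1 td1 lt1]]] :=
  two_columns (Na Z1 cZ1 aZ1 bZ1 (sZ1 _ u_s) (sZ1 _ v_s)) NZ1.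
have [c2 [d2 [c2s d2s tc2 td2 lt2]]] :=
  two_columns (Nb Z2 cZ2 bZ2 aZ2 (sZ2 _ u_s) (sZ2 _ v_s)) NZ2.
have tw1 : touch e [set w] Z1.
  by apply/touchP; exists w, (last a p1); rewrite set11 p1Z1 ?mem_last // e_sym.
have tw2 : touch e [set w] Z2.
  by apply/touchP; exists w, (last b p2); rewrite set11 p2Z2 ?mem_last // e_sym.
have sZ1' : {in u :: q, forall z, z \notin Z1}.
  by move=> z zs; rewrite sZ1 // inE zs orbT.
have sZ2' : {in u :: q, forall z, z \notin Z2}.
  by move=> z zs; rewrite sZ2 // inE zs orbT.
(* Either [c2] precedes [d1], or the positions satisfy [c1 < d1 <= c2 < d2] and [Z1], [Z2] exchange
   roles. *)
have [lt21|le12] := ltnP (index c2 (u :: q)) (index d1 (u :: q)).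
  exact: (K4_of_columns uq Ev us cZ1 cZ2 aZ1 bZ2 dZ ws (sZ2 _ w_s) uw sZ1' sZ2'
    tw1 tw2 d1s c2s d2s td1 tc2 td2).
apply: bagged_K4_swap; rewrite disjoint_sym in dZ.
apply: (K4_of_columns uq Ev us cZ2 cZ1 bZ2 aZ1 dZ ws (sZ1 _ w_s) uw sZ2' sZ1'
    tw2 tw1 d2s c1s d1s td2 tc1 td1) => //.
exact: ltn_trans (leq_trans lt1 le12) lt2.
Qed.

End FourBags.

Lemma uniq4E (T : eqType) (i j k l : T) : uniq [:: i; j; k; l] =
  [&& i != j, i != k, i != l, j != k, j != l & k != l].
Proof. by rewrite /= !inE !negb_or andbT !andbA. Qed.

Ltac permute4 u :=
  by move: u; rewrite !uniq4E => /and5P[? ? ? ? /andP[? ?]];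
     repeat (apply/andP; split); rewrite // eq_sym.

(** * Choosing a pairing of the four roots *)

Section Selection.

Implicit Types i j k l z : 'I_4.

Lemma ord4_cover i j k l z : uniq [:: i; j; k; l] -> z \in [:: i; j; k; l].
Proof.
move=> ijkl; have := uniq_min_size (s2 := enum 'I_4) ijkl.
case=> [y _||_ ->]; rewrite ?size_enum_ord ?mem_enum //.
Qed.

Lemma ord4_complement i j :
  i != j -> exists k l, uniq [:: i; j; k; l].
Proof.
move=> ij; have /card_gt1P[k [l [kN lN kl]]] : 1 < #|~: [set i; j]|.
  by rewrite -(leq_add2l #|[set i; j]|) cardsC card_ord cards2 ij.
exists k, l; move: kN lN; rewrite !inE !negb_or /= !inE !negb_or ij kl !andbT.
by rewrite ![i == _]eq_sym ![j == _]eq_sym => /andP[-> ->] /andP[-> ->].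
Qed.

(* R i j: the roots i and j are adjacent.  X k i j: the root k has a neighbour
   in the interior of the chosen path P_ij, which is a single edge if R i j. *)
Variables (R : rel 'I_4) (X : 'I_4 -> rel 'I_4).
Hypotheses (R_sym : symmetric R) (R_irr : irreflexive R).
Hypothesis X_sym : forall k, symmetric (X k).
Hypothesis RX : forall i j k l,
  uniq [:: i; j; k; l] -> ~~ R i j -> X i j k || X i j l.
Hypothesis RNX : forall i j k, R j k -> ~~ X i j k.

(** The end [l] counts as a neighbour on P_kl but [k] does not, because P_kl without [k] may have to
    serve as a bag. *)
Definition crossing i j k l :=
  [&& X k i j, X i k l || R i l & X j k l || R j l].

Let some_crossing := exists i j k l, uniq [:: i; j; k; l] && crossing i j k l.

(** The pairing [ij|kl] comes with four statements, one per root: it has a neighbour inside the path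
    joining the opposite pair. Any three of them give a crossing after renaming; here the one for
    [i] is among the three. *)
Lemma crossing_of_two i j k l :
  uniq [:: i; j; k; l] -> X i k l ->
  [|| X j k l && X k i j, X j k l && X l i j | X k i j && X l i j] ->
  some_crossing.
Proof.
move=> ijkl Xi /or3P[] /andP[XX XX'].
- by exists i, j, k, l; rewrite ijkl /crossing XX' Xi XX.
- exists i, j, l, k; apply/andP; split; first by permute4 ijkl.
  by rewrite /crossing XX' (X_sym i l) Xi (X_sym j l) XX.
- exists k, l, i, j; apply/andP; split; first by permute4 ijkl.
  by rewrite /crossing Xi XX XX'.
Qed.

(** By [RX], each root satisfies its statement in at least two of the three pairings, so some
    pairing collects three. *)
Lemma crossing_without_root_edges :
  (forall i j, ~~ R i j) -> some_crossing.
Proof.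
move=> R0.
have XX i j k l : uniq [:: i; j; k; l] -> X i j k || X i j l.
  by move=> u; apply: RX u (R0 i j).
(* Here [i] counts for the pairings [il|jk] and [ik|jl]. Each of [j], [k], [l] fails at most one
   pairing, so it counts for one of these two, and one of them collects two more roots. *)
have star i j k l : uniq [:: i; j; k; l] -> X i j k -> X i j l -> some_crossing.
  move=> u Xjk Xjl.
  have uljk : uniq [:: i; l; j; k] by permute4 u.
  have ukjl : uniq [:: i; k; j; l] by permute4 u.
  have := crossing_of_two uljk Xjk; have := crossing_of_two ukjl Xjl.
  have := XX j i k l ltac:(permute4 u); have := XX j k i l ltac:(permute4 u).
  have := XX j l i k ltac:(permute4 u).
  have := XX k i j l ltac:(permute4 u); have := XX k j i l ltac:(permute4 u).
  have := XX k l i j ltac:(permute4 u).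
  have := XX l i j k ltac:(permute4 u); have := XX l j i k ltac:(permute4 u).
  have := XX l k i j ltac:(permute4 u).
  rewrite (X_sym j k i) (X_sym j l i) (X_sym j l k).
  rewrite (X_sym k j i) (X_sym k l i) (X_sym k l j).
  rewrite (X_sym l j i) (X_sym l k i) (X_sym l k j).
  case: (X j i k); case: (X j i l); case: (X k i j) => //=;
  case: (X k i l); case: (X l i j); case: (X l i k) => //=;
  case: (X l j k); case: (X k j l) => //=; case: (X j k l) => //=; by auto.
have [k [l u]] := @ord4_complement ord0 ord_max isT.
set i := ord0 in u *; set j := ord_max in u.
have := XX i j k l u; have := XX i k j l ltac:(permute4 u).
case Xjk: (X i j k) => /=; last first.
  rewrite X_sym Xjk /= => Xkl Xjl.
  by apply: (star i l j k); rewrite ?(X_sym i l) //; permute4 u.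
move=> _ _; have := XX i l j k ltac:(permute4 u); case/orP=> [Xlj|Xlk].
  by apply: (star i j k l); rewrite // X_sym.
by apply: (star i k j l); [permute4 u | rewrite X_sym | rewrite X_sym].
Qed.

(** Otherwise [l] would have a neighbour inside P_ij or P_ik, but these are single edges. *)
Lemma root_star i j k l :
  uniq [:: i; j; k; l] -> R i j -> R i k -> R i l.
Proof.
move=> u Rij Rik; apply: contraT => Ril; rewrite R_sym in Ril.
have := @RX l i j k ltac:(permute4 u) Ril.
by rewrite X_sym (X_sym l i) !(negPf (RNX _ _)) // R_sym.
Qed.

Lemma all_root_edges i j k l :
  uniq [:: i; j; k; l] -> R i j -> R i k -> R j k ->
  forall x y, x != y -> R x y.
Proof.
move=> u Rij Rik Rjk.
have Ril := root_star u Rij Rik.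
have Rjl : R j l by apply: (@root_star j i k l); rewrite // 1?R_sym //; permute4 u.
have Rkl : R k l.
  by apply: (@root_star k i j l); rewrite // 1?R_sym //; permute4 u.
move=> x y; have := ord4_cover x u; have := ord4_cover y u.
rewrite !inE => /or4P[] /eqP-> /or4P[] /eqP->; rewrite ?eqxx // => _ //;
by rewrite R_sym.
Qed.

(** Two edges of [R] at a root force the third, and a triangle forces all edges. So [R] is empty,
    complete, a star at one root, or a matching. *)
Lemma complete_or_crossing :
  (forall i j, i != j -> R i j) \/ some_crossing.
Proof.
have [/existsP[i /existsP[j Rij]]|R0] := boolP [exists i, exists j, R i j]; last first.
  right; apply: crossing_without_root_edges => i j.
  by apply: contra R0 => Rij; apply/existsP; exists i; apply/existsP; exists j.
have ij : i != j by apply: contraTneq Rij => ->; rewrite R_irr.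
have [k [l u]] := ord4_complement ij.
have path3 x y z w : uniq [:: x; y; z; w] -> R x y -> R x z ->
    (forall i j, i != j -> R i j) \/ some_crossing.
  move=> v Rxy Rxz; have Rxw := root_star v Rxy Rxz.
  have [Ryz|Ryz] := boolP (R y z); first by left; apply: all_root_edges v Rxy Rxz Ryz.
  have [Ryw|Ryw] := boolP (R y w).
    by left; apply: (@all_root_edges x y w z) => //; permute4 v.
  (* The star has centre [x], and [y] has a neighbour inside P_zw because P_zx is an edge. *)
  right; exists z, w, y, x; apply/andP; split; first by permute4 v.
  rewrite /crossing (R_sym z) Rxz (R_sym w) Rxw !orbT !andbT.
  have := @RX y z w x ltac:(permute4 v) Ryz.
  by rewrite R_sym in Rxz; rewrite (negPf (RNX y Rxz)) orbF => ->.
have [Rik|Rik] := boolP (R i k); first exact: path3 u Rij Rik.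
have [Ril|Ril] := boolP (R i l).
  by apply: (path3 i j l k) => //; permute4 u.
have [Rjk|Rjk] := boolP (R j k).
  by apply: (path3 j i k l); rewrite // 1?R_sym //; permute4 u.
have [Rjl|Rjl] := boolP (R j l).
  by apply: (path3 j i l k); rewrite // 1?R_sym //; permute4 u.
(* No edge joins [i], [j] to [k], [l]. As P_ij is an edge, [RX] places neighbours of [k] inside P_il
   and of [l] inside P_jk, which suits the pairing [il|kj]. *)
right; have Xkil : X k i l.
  rewrite R_sym in Rik; have := @RX k i j l ltac:(permute4 u) Rik.
  by rewrite (negPf (RNX k Rij)).
have Xljk : X l j k.
  rewrite R_sym in Rjl; have := @RX l j i k ltac:(permute4 u) Rjl.
  by rewrite (X_sym l j i) (negPf (RNX l Rij)).
exists i, l, k, j; apply/andP; split; first by permute4 u.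
by rewrite /crossing Xkil Rij (X_sym l) Xljk orbT.
Qed.

End Selection.

(** * Rooted models of [K_4] and linked colourings *)

Section RootedModels.

Variable V : finType.
Implicit Types (e : rel V) (r : 'I_4 -> V) (c : V -> 'I_4).

Definition K4_model e r : Prop := exists B : 'I_4 -> {set V},
  [/\ forall i, r i \in B i,
      forall i j, i != j -> [disjoint B i & B j],
      forall i, conn e (B i) &
      forall i j, i != j -> touch e (B i) (B j)].

Lemma K4_model_of_bags e r i j k l : symmetric e -> uniq [:: i; j; k; l] ->
  bagged_K4 e (r i) (r j) (r k) (r l) -> K4_model e r.
Proof.
move=> e_sym u [A [B [C [D [[rA rB rC rD] [cA cB cC cD] [AB AC AD] [BC BD CD]]]]]].
case=> tAB tAC tAD [tBC tBD tCD].
pose bag z := nth set0 [:: A; B; C; D] (index z [:: i; j; k; l]).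
have bagE : [/\ bag i = A, bag j = B, bag k = C & bag l = D].
  move: u; rewrite uniq4E => /and5P[/negPf ij /negPf ik /negPf il /negPf jk].
  case/andP=> /negPf jl /negPf kl.
  by rewrite /bag /= ij ik il jk jl kl !eqxx.
case: bagE => bi bj bk bl.
exists bag; split=> [x|x y|x|x y]; have := ord4_cover x u; try have := ord4_cover y u;
rewrite !inE.
- by case/or4P=> /eqP->; rewrite ?bi ?bj ?bk ?bl.
- case/or4P=> /eqP-> /or4P[] /eqP->; rewrite ?eqxx // => _;
  by rewrite ?bi ?bj ?bk ?bl // disjoint_sym.
- by case/or4P=> /eqP->; rewrite ?bi ?bj ?bk ?bl.
- case/or4P=> /eqP-> /or4P[] /eqP->; rewrite ?eqxx // => _;
  by rewrite ?bi ?bj ?bk ?bl // touch_sym.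
Qed.

Definition two_colored c i j : {set V} := [set x | (c x == i) || (c x == j)].

Lemma two_coloredC c i j : two_colored c i j = two_colored c j i.
Proof. by apply/setP=> x; rewrite !inE orbC. Qed.

Definition kempe_linked e r c : Prop :=
  (forall i, c (r i) = i) /\
  (forall i j, connect (within e (two_colored c i j)) (r i) (r j)).

Definition edges e : {set V * V} := [set p | e p.1 p.2].

Lemma connect_homo (T : finType) (e1 : rel V) (e2 : rel T) (f : V -> T) x y :
  (forall a b, e1 a b -> connect e2 (f a) (f b)) ->
  connect e1 x y -> connect e2 (f x) (f y).
Proof.
move=> h /connectP[p]; elim: p x => [|z p IHp] x /=; first by move=> _ ->; apply: connect0.
by case/andP=> xz zp Ey; apply: connect_trans (h _ _ xz) (IHp _ zp Ey).
Qed.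

(** * Contracting an edge *)

Section Contraction.

Variables (e : rel V) (x y : V).
Hypotheses (e_sym : symmetric e) (exy : e x y).

Definition merge z := if z == y then x else z.

(* The contracted graph lives on the same vertex type: y becomes isolated. *)
Definition contracted : rel V := [rel a b | (a != b) &&
  [exists p, exists q, [&& merge p == a, merge q == b & e p q]]].

Lemma contractedP a b :
  reflect (a <> b /\ exists p q, [/\ merge p = a, merge q = b & e p q])
          (contracted a b).
Proof.
apply: (iffP andP) => -[/eqP ab h]; split=> //.
  by case/existsP: h => p /existsP[q /and3P[/eqP ? /eqP ? ?]]; exists p, q.
case: h => p [q [<- <- pq]]; apply/existsP; exists p; apply/existsP; exists q.
by rewrite !eqxx.
Qed.

Lemma merge_idem z : merge (merge z) = merge z.
Proof.
by rewrite /merge; case: (eqVneq z y) => [_|/negPf-> //]; case: ifP.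
Qed.

Lemma contracted_sym : symmetric contracted.
Proof.
move=> a b; apply/contractedP/contractedP => -[ab [p [q [pa qb pq]]]];
by split; [exact: nesym | exists q, p; rewrite e_sym].
Qed.

Lemma contracted_irr : irreflexive contracted.
Proof. by move=> a; apply/contractedP=> -[]. Qed.

(** The pair [(x, y)] would become a loop and is lost; every contracted edge is the image of another
    pair under [merge]. *)
Lemma card_contracted : #|edges contracted| < #|edges e|.
Proof.
have xyE : (x, y) \in edges e by rewrite inE.
rewrite [#|edges e|](cardsD1 (x, y)) xyE add1n ltnS.
pose f p := (merge p.1, merge p.2).
apply: leq_trans (leq_imset_card f (mem (edges e :\ (x, y)))).
apply/subset_leq_card/subsetP=> -[a b].
rewrite inE => /contractedP[ab [p [q [pa qb pq]]]].
apply/imsetP; exists (p, q); last by rewrite /f /= pa qb.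
rewrite !inE /= pq andbT; apply/eqP=> -[px qy]; case: ab.
by rewrite -pa -qb px qy /merge eqxx; case: ifP.
Qed.

(** As [x] and [y] share a colour, [merge] preserves every two-coloured set, so linking walks map to
    linking walks. *)
Lemma kempe_linked_contracted r c : c x = c y -> (forall i, r i != y) ->
  kempe_linked e r c -> kempe_linked contracted r c.
Proof.
move=> cxy ry [cr lk]; split=> // i j.
have mr k : r k = merge (r k) by rewrite /merge (negPf (ry k)).
rewrite (mr i) (mr j); apply: connect_homo (lk i j) => a b /and3P[aS bS ab].
have mS z : z \in two_colored c i j -> merge z \in two_colored c i j.
  by rewrite /merge; case: eqP => // ->; rewrite !inE cxy.
have [->|mab] := eqVneq (merge a) (merge b); first exact: connect0.
apply: connect1; rewrite /within /= !mS //=; apply/contractedP.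
by split; [exact/eqP | exists a, b].
Qed.

(** Bags are pulled back along [merge]: a bag with [x] also receives [y], attached by the edge
    [exy]. *)
Lemma K4_model_contracted r : (forall i, r i != y) ->
  K4_model contracted r -> K4_model e r.
Proof.
move=> ry [B [rB disB cB tB]].
pose B' i := merge @^-1: B i.
have mB i z : z \in B' i -> merge z \in B' i by rewrite !inE merge_idem.
have zm i z : z \in B' i -> connect (within e (B' i)) (merge z) z.
  move=> zB; have := mB i z zB; rewrite /merge.
  case: eqP => [zy|_] xB; last exact: connect0.
  by apply: connect1; rewrite /within /= xB zB zy.
exists B'; split.
- by move=> i; rewrite inE /merge (negPf (ry i)).
- move=> i j /disB dij; apply: disjoint_in => z; rewrite !inE => zi.
  by rewrite (disjointFr dij zi).
- move=> i a b aB bB.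
  have stepB p q : within contracted (B i) p q -> connect (within e (B' i)) p q.
    case/and3P=> pB qB /contractedP[_ [p' [q' [Ep Eq pq]]]].
    have p'B : p' \in B' i by rewrite inE Ep.
    have q'B : q' \in B' i by rewrite inE Eq.
    rewrite -Ep -Eq; apply: connect_trans (zm _ _ p'B) _.
    rewrite within_sym //; apply: connect_trans (zm _ _ q'B) _; rewrite within_sym //.
    by apply: connect1; rewrite /within /= p'B q'B.
  have ab : connect (within e (B' i)) (merge a) (merge b).
    apply: (connect_homo (f := id)) (cB i (merge a) (merge b) _ _) => //.
    + by rewrite inE in aB.
    + by rewrite inE in bB.
  apply: connect_trans (connect_trans _ ab) (zm _ _ bB).
  by rewrite within_sym //; apply: zm.
move=> i j /tB/touchP[a [b [aB bB /contractedP[_ [p [q [pa qb pq]]]]]]].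
by apply/touchP; exists p, q; rewrite !inE pa qb.
Qed.

End Contraction.

(** * Recolouring, given that a monochromatic edge suffices *)

Section Reduction.

Variables (e : rel V) (r : 'I_4 -> V).
Hypothesis e_sym : symmetric e.
Hypothesis monochromatic : forall c x y,
  kempe_linked e r c -> e x y -> c x = c y -> K4_model e r.

Lemma two_colored_neighbor c i j (Z : {set V}) :
  kempe_linked e r c -> r i \in Z -> r j \notin Z ->
  exists y z, [/\ y \in Z, z \in nbhd e Z, e y z,
    y \in two_colored c i j & z \in two_colored c i j].
Proof.
case=> _ lk riZ rjZ.
have [y [z [yZ zZ /and3P[yc zc yz]]]] := connect_cut (lk i j) riZ rjZ.
exists y, z; split=> //.
by rewrite inE zZ; apply/exists_inP; exists y.
Qed.

(** [Z] takes the colour [i]. Two-coloured sets involving [i] only grow, and the other links avoid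
    [Z], so all links survive. If no edge is monochromatic now, the link from [r i] to each other
    [r j] leaves [Z] at a vertex of colour [j], giving three neighbours. *)
Lemma recolored_K4_model c i (Z : {set V}) :
  kempe_linked e r c -> r i \in Z -> (forall j, j != i -> r j \notin Z) ->
  (forall j k, j != i -> k != i ->
    connect (within e (two_colored c j k :\: Z)) (r j) (r k)) ->
  K4_model e r \/ 2 < #|nbhd e Z|.
Proof.
move=> lkc riZ rZ lkZ; have [cr lk] := lkc.
pose c' z := if z \in Z then i else c z.
have c'Z z : z \notin Z -> c' z = c z by rewrite /c' => /negPf->.
have sub_i k : two_colored c i k \subset two_colored c' i k.
  by apply/subsetP=> z; rewrite !inE /c'; case: ifP => // _ _; rewrite eqxx.
have lkc' : kempe_linked e r c'.
  split=> [j|j k].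
    by have [->|/rZ/c'Z->//] := eqVneq j i; rewrite /c' riZ.
  have [->|ji] := eqVneq j i; first exact: within_mono (sub_i k) _ _ (lk i k).
  have [->|ki] := eqVneq k i.
    by rewrite two_coloredC; apply: within_mono (sub_i j) _ _ _; rewrite two_coloredC.
  apply: within_mono (lkZ j k ji ki); apply/subsetP=> z /setDP[zc zZ].
  by move: zc; rewrite !inE c'Z.
have [/existsP[y /existsP[z /andP[yz /eqP Ec]]]|nomono] :=
    boolP [exists y, exists z, e y z && (c' y == c' z)].
  by left; apply: monochromatic lkc' yz Ec.
right.
have nbr j : j != i -> exists2 z, z \in nbhd e Z & c z = j.
  move=> ji; have [y [z [yZ zN yz _ zc]]] := two_colored_neighbor lkc' riZ (rZ j ji).
  have zZ : z \notin Z by move: zN; rewrite inE => /andP[].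
  exists z => //; move: zc; rewrite inE c'Z // => /orP[/eqP Ez|/eqP//].
  case/negP: nomono; apply/existsP; exists y; apply/existsP; exists z.
  by rewrite yz (c'Z z) // Ez /c' yZ /=.
have [j ij] : exists j, i != j.
  have [Ei|i0] := eqVneq i ord0; last by exists ord0.
  by exists ord_max; rewrite Ei.
have [k [l]] := ord4_complement ij; rewrite uniq4E.
case/and5P=> _ ik il jk /andP[jl kl].
have [x xN cx] := nbr j (ltac:(by rewrite eq_sym)).
have [y yN cy] := nbr k (ltac:(by rewrite eq_sym)).
have [z zN cz] := nbr l (ltac:(by rewrite eq_sym)).
apply/card_gt2P; exists x, y, z; split=> //; rewrite -cx -cy -cz in jk jl kl.
by split; [apply: contraNneq jk | apply: contraNneq kl | apply: contraNneq jl] => ->.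
Qed.

(** If [r j] and [r k] cannot be linked outside [Z], their components in [S] are distinct and each
    contains a neighbour of [Z]; a third neighbour comes from the link between [r i] and the fourth
    root. *)
Lemma K4_model_or_separation c i (Z : {set V}) :
  kempe_linked e r c -> r i \in Z -> (forall j, j != i -> r j \notin Z) ->
  K4_model e r \/ 2 < #|nbhd e Z|.
Proof.
move=> lkc riZ rZ; have [cr lk] := lkc.
have [N3|N2] : 2 < #|nbhd e Z| \/ #|nbhd e Z| <= 2 by case: ltnP; [left | right].
  by right.
suff lkZ j k : j != i -> k != i ->
    connect (within e (two_colored c j k :\: Z)) (r j) (r k).
  exact: recolored_K4_model lkc riZ rZ lkZ.
move=> ji ki; have [->|jk] := eqVneq j k; first exact: connect0.
apply: contraLR N2 => njk; rewrite -ltnNge.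
set S := two_colored c j k :\: Z.
have exit a b : connect (within e (two_colored c j k)) (r a) (r b) ->
    ~~ connect (within e S) (r a) (r b) -> r a \in S ->
    exists2 x, x \in comp e S (r a) & x \in nbhd e Z.
  move=> ab nab aS.
  have bC : r b \notin comp e S (r a) by rewrite inE.
  have [x [y [xC yC /and3P[_ yc xy]]]] := connect_cut ab (mem_comp e S _) bC.
  exists x => //; have xS := subsetP (comp_sub e aS) x xC.
  have xZ : x \notin Z by case/setDP: xS.
  have yZ : y \in Z.
    apply: contraR yC => yZ; apply: comp_closed xy => //.
    by rewrite inE yZ.
  by rewrite inE xZ; apply/exists_inP; exists y; rewrite // e_sym.
have jS : r j \in S by rewrite !inE rZ // cr eqxx.
have kS : r k \in S by rewrite !inE rZ // cr eqxx orbT.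
have [x xC xN] := exit j k (lk j k) njk jS.
have [||y yC yN] := exit k j _ _ kS.
- by rewrite two_coloredC; apply: lk.
- by rewrite within_sym.
have xy : x != y.
  apply: contraNneq njk => Exy; move: xC yC; rewrite Exy !inE => jy ky.
  by apply: connect_trans jy _; rewrite within_sym.
have xS := subsetP (comp_sub e jS) x xC; have yS := subsetP (comp_sub e kS) y yC.
have [l [m u]] := ord4_complement jk; move: (u); rewrite uniq4E.
case/and5P=> _ jl jm kl /andP[km lm].
have [l' [jl' kl' il']] : exists l', [/\ j != l', k != l' & l' != i].
  have := ord4_cover i u; rewrite !inE ![i == _]eq_sym (negPf ji) (negPf ki) /=.
  case/orP=> /eqP Ei; [exists m | exists l]; split=> //; rewrite -Ei //.
  by rewrite eq_sym.
(* This link leaves [Z] at a vertex coloured [i] or [l'], hence outside [S]. *)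
have [_ [z [_ zN _ _ zc]]] := two_colored_neighbor lkc riZ (rZ l' il').
have zS t : t \in S -> t != z.
  case/setDP=> tc _; apply: contraTneq tc => ->; move: zc; rewrite !inE negb_or.
  by case/orP=> /eqP->; rewrite 1?eq_sym ?ji ?jl' 1?eq_sym ?ki ?kl'.
apply/card_gt2P; exists x, y, z; split=> //.
by split=> //; [exact: zS | rewrite eq_sym; exact: zS].
Qed.

(** Giving [u] the colour [i] makes its edge to [r i] monochromatic. Only the links from [r j] to
    [r k] and [r l] could be broken, and they can avoid [u]. *)
Lemma neighbor_recolored c i j k l u :
  kempe_linked e r c -> uniq [:: i; j; k; l] -> e (r i) u -> c u = j -> u != r j ->
  connect (within e (two_colored c j k :\ u)) (r j) (r k) ->
  connect (within e (two_colored c j l :\ u)) (r j) (r l) ->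
  K4_model e r.
Proof.
move=> lkc uijkl riu cu urj ljk ljl; have [cr lk] := lkc.
pose c' z := if z == u then i else c z.
move: (uijkl); rewrite uniq4E => /and5P[ij ik il jk /andP[jl kl]].
have ru a : (r a == u) = false.
  apply/negbTE; apply: contraNneq urj => Ea; rewrite -Ea; move: cu.
  by rewrite -Ea cr => ->.
have sub_i a : two_colored c i a \subset two_colored c' i a.
  by apply/subsetP=> z; rewrite !inE /c'; case: ifP => // _ _; rewrite eqxx.
have sub_u a b : two_colored c a b :\ u \subset two_colored c' a b.
  by apply/subsetP=> z; rewrite !inE /c' => /andP[/negPf->].
have sub_nj a b : j != a -> j != b -> two_colored c a b \subset two_colored c' a b.
  move=> ja jb; apply: subset_trans (sub_u a b); apply/subsetP=> z zc.
  rewrite in_setD1 zc andbT; apply: contraTneq zc => ->.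
  by rewrite inE cu negb_or ja.
have lkc' : kempe_linked e r c'.
  split=> [a|]; first by rewrite /c' ru.
  (* By symmetry, [j] may be taken as the first index whenever it occurs. *)
  suff lk' a b : (a == j) || (b != j) ->
      connect (within e (two_colored c' a b)) (r a) (r b).
    move=> a b; have [|] := boolP ((a == j) || (b != j)); first exact: lk'.
    rewrite negb_or negbK => /andP[aj /eqP->].
    by rewrite within_sym // two_coloredC; apply: lk'; rewrite eqxx.
  case: eqVneq => [->|aj] /=; last first.
    by rewrite eq_sym in aj => bj; rewrite eq_sym in bj;
      apply: within_mono (sub_nj _ _ aj bj) _ _ (lk a b).
  move=> _; have := ord4_cover b uijkl; rewrite !inE => /or4P[]/eqP->.
  - rewrite two_coloredC; apply: within_mono (sub_i j) _ _ _.
    by rewrite two_coloredC.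
  - exact: connect0.
  - exact: within_mono (sub_u j k) _ _ ljk.
  - exact: within_mono (sub_u j l) _ _ ljl.
apply: monochromatic lkc' riu _.
by rewrite /c' ru eqxx cr.
Qed.

End Reduction.

End RootedModels.

(** * Kempe paths between roots *)

Section KempePaths.

Variables (V : finType) (e : rel V) (r : 'I_4 -> V) (c : V -> 'I_4).
Hypothesis e_sym : symmetric e.
Hypothesis lkc : kempe_linked e r c.
Implicit Types (i j k l : 'I_4) (s : seq V).

(** The last clause leaves the path without interior when the two roots are adjacent. *)
Definition kempe_path i j s : Prop := exists p,
  [/\ s = r i :: p, path e (r i) p /\ last (r i) p = r j, uniq s,
      {subset s <= two_colored c i j} & e (r i) (r j) -> p = [:: r j]].

Lemma root_inj : injective r.
Proof. by case: lkc => cr _; apply: can_inj cr. Qed.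

Lemma kempe_path_exists i j : i != j -> exists s, kempe_path i j s.
Proof.
move=> ij; have [cr lk] := lkc.
have rij : r i != r j by rewrite (inj_eq root_inj).
have [rirj|nrirj] := boolP (e (r i) (r j)).
  exists [:: r i; r j], [:: r j]; split=> //=; rewrite ?rirj ?inE ?rij //.
  by move=> z; rewrite !inE => /orP[] /eqP->; rewrite cr eqxx ?orbT.
have /connectP[p0 p0P Ep0] := lk i j.
case/shortenP: p0P Ep0 => p pP up _ Ep.
exists (r i :: p), p; split=> //; last by rewrite (negPf nrirj).
  by split=> //; apply: sub_path pP => x y /and3P[].
move=> z; rewrite inE => /orP[/eqP->|zp]; first by rewrite !inE cr eqxx.
have zrp : z \in r i :: p by rewrite inE zp orbT.
have riz := path_connect pP zrp.
have riS : r i \in two_colored c i j by rewrite !inE cr eqxx.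
by apply: (subsetP (comp_sub e riS)); rewrite inE.
Qed.

Lemma kempe_path_rev i j s : kempe_path i j s -> kempe_path j i (rev s).
Proof.
case=> p [-> [pP Ep] us sub dir].
exists (rev (belast (r i) p)); split.
- by rewrite lastI rev_rcons Ep.
- split; first by rewrite -Ep rev_path (eq_path (e' := e)) // => x y; rewrite e_sym.
  by case: p Ep {pP us sub dir} => [<-|x p _] //=; rewrite rev_cons last_rcons.
- by rewrite rev_uniq.
- by move=> x; rewrite mem_rev two_coloredC; apply: sub.
- by rewrite e_sym => /dir ->.
Qed.

(** One path is chosen per pair and reversed for the other order, so having a neighbour inside it is
    symmetric in the pair. The diagonal entries are dummies. *)
Lemma kempe_paths_exist : exists s : 'I_4 -> 'I_4 -> seq V,
  (forall i j, i != j -> kempe_path i j (s i j)) /\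
  (forall i j x, (x \in s i j) = (x \in s j i)).
Proof.
have /fin_all_exists[s0 s0P] i :
    exists t : 'I_4 -> seq V, forall j, i != j -> kempe_path i j (t j).
  apply: (fin_all_exists (P := fun j s => i != j -> kempe_path i j s)) => j.
  have [_|/kempe_path_exists[s sP]] := eqVneq i j; first by exists [::].
  by exists s.
exists (fun i j => if i < j then s0 i j else rev (s0 j i)); split=> [i j|i j x].
  move=> ij; case: ltnP => _; first exact: s0P.
  by apply: kempe_path_rev; apply: s0P; rewrite eq_sym.
by case: ltngtP; rewrite ?mem_rev // => /val_inj->.
Qed.

Lemma mem_kempe_path_ends i j s : kempe_path i j s -> r i \in s /\ r j \in s.
Proof. by case=> p [-> [_ <-] _ _ _]; rewrite mem_head mem_last. Qed.

Lemma kempe_path_connect i j s (Z : {set V}) :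
  kempe_path i j s -> {subset s <= Z} -> connect (within e Z) (r i) (r j).
Proof.
case=> p [-> [pP Ep] _ _ _] sZ.
by have := path_connect (within_path sZ pP) (mem_last (r i) p); rewrite Ep.
Qed.

Lemma kempe_paths_disjoint i j k l s t : uniq [:: i; j; k; l] ->
  kempe_path i j s -> kempe_path k l t -> {in s, forall x, x \notin t}.
Proof.
rewrite uniq4E => /and5P[ij ik il jk /andP[jl kl]].
case=> _ [_ _ _ ss _] [_ [_ _ _ st _]] x /ss xs; apply/negP=> /st.
move: xs; rewrite !inE => /orP[]/eqP->.
  by rewrite (negPf ik) (negPf il).
by rewrite (negPf jk) (negPf jl).
Qed.

End KempePaths.

(** * The case of [K_4] with all pairs linked *)

Section K4.

Variable V : finType.
Implicit Types (e : rel V) (r : 'I_4 -> V) (c : V -> 'I_4).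

Lemma K4_model_step e r c : symmetric e -> irreflexive e ->
  (forall c x y, kempe_linked e r c -> e x y -> c x = c y -> K4_model e r) ->
  kempe_linked e r c -> K4_model e r.
Proof.
move=> e_sym e_irr mono lkc; have [cr lk] := lkc.
have r_inj := root_inj lkc.
have [/existsP[x /existsP[y /andP[xy /eqP Ec]]]|proper] :=
  boolP [exists x, exists y, e x y && (c x == c y)]; first exact: mono lkc xy Ec.
have {}proper x y : e x y -> c x != c y.
  move=> xy; apply: contra proper => Ec.
  by apply/existsP; exists x; apply/existsP; exists y; rewrite xy.
have [/forallP sep|nosep] := boolP [forall i, forall Z : {set V},
    (r i \in Z) ==> [forall j, (j != i) ==> (r j \notin Z)] ==> (2 < #|nbhd e Z|)];
  last first.
  have [i] := existsP nosep; move=> /forallPn[Z].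
  rewrite !negb_imply => /and3P[riZ /forallP rZ N2].
  have [//|N3] := K4_model_or_separation e_sym mono lkc riZ (fun j => implyP (rZ j)).
  by rewrite N3 in N2.
have {}sep i (Z : {set V}) : r i \in Z -> (forall j, j != i -> r j \notin Z) ->
    2 < #|nbhd e Z|.
  move=> riZ rZ; have /forallP/(_ Z) := sep i; rewrite riZ /=.
  by move/implyP; apply; apply/forallP=> j; apply/implyP/rZ.
have [s [sP sC]] := kempe_paths_exist e_sym lkc.
pose R : rel 'I_4 := fun i j => e (r i) (r j).
pose X k : rel 'I_4 := fun i j =>
  [exists w, [&& w \in s i j, w != r i, w != r j & e (r k) w]].
have X_sym k : symmetric (X k).
  by move=> i j; apply: eq_existsb => w; rewrite sC; congr (_ && _); rewrite andbCA.
have [RX|] := boolP [forall i, forall j, forall k, forall l,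
    uniq [:: i; j; k; l] ==> ~~ R i j ==> X i j k || X i j l]; last first.
  move=> /forallPn[i /forallPn[j /forallPn[k /forallPn[l]]]].
  rewrite !negb_imply negb_or => /and4P[u nR nXk nXl].
  move: (u); rewrite uniq4E => /and5P[ij ik il jk /andP[jl kl]].
  have rji : r j \notin [set r i] by rewrite inE (inj_eq r_inj) eq_sym.
  (* With [Z = {r i}], the link to [r j] provides a neighbour [z] of [r i], coloured [j] because the
     colouring is now proper. If (2) fails, P_jk and P_jl both avoid [z]. *)
  have [_ [z [/set1P-> _ riz _ zc]]] := two_colored_neighbor lkc (set11 _) rji.
  have cz : c z = j.
    move: zc (proper _ _ riz); rewrite inE cr => /orP[/eqP->|/eqP->//].
    by rewrite eqxx.
  have zrj : z != r j by apply: contraNneq nR => Ez; rewrite /R -Ez.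
  have avoid m : j != m -> ~~ X i j m ->
      connect (within e (two_colored c j m :\ z)) (r j) (r m).
    move=> jm nX; have sjm := sP j m jm; apply: (kempe_path_connect sjm) => x xs.
    have [p [_ _ _ sub _]] := sjm; rewrite in_setD1 sub // andbT.
    apply: contraNneq nX => Exz; rewrite Exz in xs.
    apply/existsP; exists z; rewrite xs zrj riz andbT /=.
    by apply: contraNneq jm => Ez; rewrite -cz Ez cr.
  apply: (neighbor_recolored e_sym mono lkc u riz cz zrj (avoid k jk nXk)).
  exact: avoid.
have {}RX i j k l : uniq [:: i; j; k; l] -> ~~ R i j -> X i j k || X i j l.
  move=> u nR; move/forallP/(_ i)/forallP/(_ j)/forallP/(_ k)/forallP/(_ l): RX.
  by rewrite u nR.
have RNX i j k : R j k -> ~~ X i j k.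
  move=> Rjk; have jk : j != k by apply: contraTneq Rjk => ->; rewrite /R e_irr.
  have [p [Es _ _ _ /(_ Rjk) Ep]] := sP j k jk.
  apply/existsP=> -[w]; rewrite Es Ep !inE => /and4P[wjk /negPf wj /negPf wk _].
  by rewrite wj wk in wjk.
have [allR|[i [j [k [l /andP[u /and3P[Xk Yi Yj]]]]]]] :=
    complete_or_crossing (fun i j => e_sym (r i) (r j)) (fun i => e_irr (r i))
      X_sym RX RNX.
  exists (fun i => [set r i]); split=> [i|i j ij|i|i j ij].
  - exact: set11.
  - by rewrite disjoints1 inE (inj_eq r_inj).
  - exact: conn1.
  - by apply/touchP; exists (r i), (r j); rewrite !set11; split=> //; apply: allR.
apply: (K4_model_of_bags e_sym u).
move: (u); rewrite uniq4E => /and5P[ij ik il jk /andP[jl kl]].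
have [p [Eij [pP Ep] up _ _]] := sP i j ij.
have [q [Ekl [qP Eq] uq _ _]] := sP k l kl.
have dis := kempe_paths_disjoint u (sP i j ij) (sP k l kl).
(* [q] is P_kl without [r k], so an edge to [r l] also provides a target in [q]. *)
have target m : X m k l || R m l -> exists2 x, x \in q & e (r m) x.
  case/orP=> [/existsP[x]|Rml]; last first.
    exists (r l) => //; have [_] := mem_kempe_path_ends (sP k l kl).
    by rewrite Ekl inE (inj_eq r_inj) eq_sym (negPf kl).
  rewrite Ekl inE => /and4P[/orP[->//|xq] _ _ mx]; by exists x.
have [x xq ix] := target i Yi; have [y yq jy] := target j Yj.
case/existsP: Xk => w; rewrite Eij inE => /and4P[ws wi wj kw].
rewrite (negPf wi) /= in ws.
case/splitPr: ws pP Ep up Eij => p1 p2 pP Ep up Eij.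
move: pP; rewrite cat_path /= => /and3P[ip1 p1w wp2].
rewrite last_cat /= in Ep.
case: p2 => [|z p2] in wp2 Ep up Eij *; first by rewrite -Ep /= eqxx in wj.
(* Reversed, the part of P_ij after [w] starts at [r j] and ends next to [w], as [crossing_paths_K4]
   expects. *)
have Erev : r j :: rev (belast z p2) = rev (z :: p2).
  by rewrite [in RHS]lastI rev_rcons -Ep.
have /andP[jp2 p2w] : path e (r j) (rev (belast z p2)) &&
    e (last (r j) (rev (belast z p2))) w.
  rewrite -rcons_path -Ep -[last w _]/(last w (z :: p2)) -rev_cons.
  rewrite -[w :: _]/(belast w (z :: p2)) rev_path.
  by rewrite (eq_path (e' := e)) // => ? ?; rewrite e_sym.
have memP a : (a \in r j :: rev (belast z p2)) = (a \in z :: p2).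
  by rewrite Erev mem_rev.
rewrite Eij -cat_cons cat_uniq in up; rewrite Ekl in uq.
case/and3P: up => _ /hasPn dis12 /andP[wp2' _].
have in_s a : (a \in s i j) = [|| a \in r i :: p1, a == w | a \in z :: p2].
  by rewrite Eij -cat_cons mem_cat [a \in w :: _]inE.
rewrite Ekl in dis.
apply: (crossing_paths_K4 e_sym (w := w) (q := q) (c := x) (d := y) ip1 p1w jp2 p2w) => //.
- move=> a ap1; rewrite memP; apply/negP=> ap2.
  by have := dis12 a; rewrite inE ap2 orbT ap1 => /(_ isT).
- by apply: dis12; rewrite mem_head.
- by rewrite memP.
- by apply: dis; rewrite in_s eqxx orbT.
- by move=> a ap1; apply: dis; rewrite in_s ap1.
- by move=> a; rewrite memP => ap2; apply: dis; rewrite in_s ap2 !orbT.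
- move=> Z _ riZ rjZ rkZ rlZ; apply: sep riZ _ => m; have := ord4_cover m u.
  by rewrite !inE => /or4P[]/eqP-> //; rewrite eqxx.
- move=> Z _ rjZ riZ rkZ rlZ; apply: sep rjZ _ => m; have := ord4_cover m u.
  by rewrite !inE => /or4P[]/eqP-> //; rewrite eqxx.
Qed.

Theorem kempe_linked_K4 e r c : symmetric e -> irreflexive e ->
  kempe_linked e r c -> K4_model e r.
Proof.
have [n] := ubnP #|edges e|.
elim: n => // n IHn in e r c *; rewrite ltnS => en e_sym e_irr.
apply: K4_model_step => // {}c x y lkc xy cxy.
have [cr _] := lkc.
(* The vertex merged away must not be a root. Roots of equal colour coincide, so at most one end is
   a root, and the edge can be turned around. *)
have [x' [y' [x'y' cx'y' ry']]] : exists x' y',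
    [/\ e x' y', c x' = c y' & forall i, r i != y'].
  have [ry|] := boolP [forall i, r i != y].
    by exists x, y; split=> //; apply/forallP.
  case/forallPn=> j; rewrite negbK => /eqP Ey.
  exists y, x; split; rewrite // 1?e_sym // => i.
  apply: contraTneq xy => Ex; rewrite -Ex -Ey in cxy *.
  by rewrite !cr in cxy; rewrite cxy e_irr.
apply: (K4_model_contracted e_sym x'y' ry').
apply: (IHn _ _ c).
- exact: leq_trans (card_contracted x'y') en.
- exact: contracted_sym.
- exact: contracted_irr.
- exact: kempe_linked_contracted.
Qed.

End K4.

(** * Links for a prescribed set of pairs *)

Section Demands.

Variables (V : finType) (e : rel V) (r : 'I_4 -> V) (c : V -> 'I_4) (D : rel 'I_4).
Hypotheses (e_sym : symmetric e) (e_irr : irreflexive e) (D_sym : symmetric D).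
Hypothesis cr : forall i, c (r i) = i.
Hypothesis lk :
  forall i j, D i j -> connect (within e (two_colored c i j)) (r i) (r j).

(** Roots of a pair outside [D] are joined by a new edge. Each bag contains only its own root, so no
    new edge lies inside a bag, and one between the bags of [i] and [j] must join [r i] to [r j],
    which [D i j] excludes. *)
Lemma demanded_model : exists B : 'I_4 -> {set V},
  [/\ forall i, r i \in B i,
      forall i j, i != j -> [disjoint B i & B j],
      forall i, conn e (B i) &
      forall i j, i != j -> D i j -> touch e (B i) (B j)].
Proof.
have r_inj : injective r by apply: can_inj cr.
pose added : rel V := [rel x y | [exists i, exists j,
  [&& i != j, ~~ D i j, x == r i & y == r j]]].
pose e' : rel V := [rel x y | e x y || added x y].
have addedP x y :
    reflect (exists i j, [/\ i != j, ~~ D i j, x = r i & y = r j]) (added x y).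
  apply: (iffP existsP) => [[i /existsP[j /and4P[ij nD /eqP-> /eqP->]]]|].
    by exists i, j.
  by case=> i [j [ij nD -> ->]]; exists i; apply/existsP; exists j; rewrite ij nD !eqxx.
have added_sym : symmetric added.
  by move=> x y; apply/addedP/addedP=> -[i [j [ij nD -> ->]]]; exists j, i;
    rewrite eq_sym D_sym.
have e'_sym : symmetric e' by move=> x y; rewrite /e' /= e_sym added_sym.
have e'_irr : irreflexive e'.
  move=> x; rewrite /e' /= e_irr; apply/addedP=> -[i [j [ij _ ->]]].
  by move/r_inj/eqP; rewrite (negPf ij).
have lk' : kempe_linked e' r c.
  split=> // i j; have [->|ij] := eqVneq i j; first exact: connect0.
  have [/lk|nD] := boolP (D i j).
    apply: (connect_homo (f := id)) => a b /and3P[aS bS ab].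
    by apply: connect1; rewrite /within /e' /= aS bS ab.
  apply: connect1; rewrite /within /e' /= !inE !cr !eqxx orbT.
  by apply/orP; right; apply/addedP; exists i, j.
have [B [rB disB cB tB]] := kempe_linked_K4 e'_sym e'_irr lk'.
have rB_eq i a : r a \in B i -> a = i.
  move=> ai; apply/eqP; apply: contraT => /disB dai.
  by rewrite (disjointFr dai (rB a)) in ai.
exists B; split=> // [i x y xB yB|i j ij Dij].
  apply: (connect_homo (f := id)) (cB i x y xB yB) => a b /and3P[aB bB] /orP[ab|].
    by apply: connect1; rewrite /within /= aB bB.
  case/addedP=> k [l [kl _ Ea Eb]]; move: kl.
  by rewrite (rB_eq i k) -?Ea // (rB_eq i l) -?Eb // eqxx.
have /touchP[x [y [xB yB /orP[xy|/addedP[k [l [_ nD Ex Ey]]]]]]] := tB i j ij.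
  by apply/touchP; exists x, y.
by move: nD; rewrite (rB_eq i k) -?Ex // (rB_eq j l) -?Ey // Dij.
Qed.

End Demands.

(** * From the routing graph to two-coloured links *)

Section RoutingGraph.

Variables (V : finType) (G : graph V) (C : {set {set V}}) (T : {set V}).
Hypotheses (partC : partition C [set: V]) (transT : transversal_of C T).

Lemma transversal_uniq A x y :
  A \in C -> x \in T -> y \in T -> x \in A -> y \in A -> x = y.
Proof.
move=> AC xT yT xA yA; have /and3P[_ _ /forall_inP/(_ A AC)/cards1P[z Ez]] := transT.
have : x \in T :&: A by rewrite inE xT.
have : y \in T :&: A by rewrite inE yT.
by rewrite Ez !inE => /eqP-> /eqP->.
Qed.

Lemma representative_exists : exists rep : V -> {x | x \in T},
  forall A v, A \in C -> v \in A -> val (rep v) \in A.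
Proof.
have /fin_all_exists[rep repP] v : exists s : {x | x \in T}, val s \in pblock C v.
  have vC : pblock C v \in C.
    by rewrite pblock_mem // (cover_partition partC) inE.
  have /and3P[_ _ /forall_inP/(_ _ vC)/cards1P[z Ez]] := transT.
  have /setIP[zT zA] : z \in T :&: pblock C v by rewrite Ez set11.
  by exists (exist _ z zT).
exists rep => A v AC vA; have /and3P[_ trivC _] := partC.
by rewrite -(def_pblock trivC AC vA).
Qed.

Lemma routing_adj_connect (s t : {x | x \in T}) :
  routing_adj G C s t -> exists A B, [/\ A \in C, B \in C, val s \in A, val t \in B &
    connect (induced G (A :|: B)) (val s) (val t)].
Proof.
case/andP=> st /existsP[X /and3P[chainX sX tX]].
have [A /andP[AC /existsP[B /and3P[BC AB XK]]]] := existsP chainX.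
case/imsetP: XK => x xAB EX; rewrite {}EX in sX tX.
move: sX tX; rewrite !inE => /andP[sAB xs] /andP[tAB xt].
have con : connect (induced G (A :|: B)) (val s) (val t).
  apply: connect_trans xt; rewrite sym_connect_sym // => a b.
  by rewrite /induced /= adj_sym andbCA.
have neq E : E \in C -> val s \in E -> val t \notin E.
  move=> EC sE; apply: contra st => tE; rewrite -val_eqE; apply/eqP.
  exact: transversal_uniq EC (valP s) (valP t) sE tE.
case/orP: sAB => sE; move: tAB; rewrite (negPf (neq _ _ sE)) // ?orbF => tE.
  by exists A, B.
by exists B, A; rewrite setUC.
Qed.

End RoutingGraph.

(** * Padding to four colours *)

Theorem theorem4 (W : finType) (K : graph W) (hK : #|W| <= 4) :
  property_star K.
Proof.
move=> V G C T H /andP[partC _] _ transT HR [f f_bij _].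
have T4 : #|{: {x : V | x \in T}}| <= 4 by rewrite (bij_eq_card f_bij).
pose num (s : {x : V | x \in T}) : 'I_4 := widen_ord T4 (enum_rank s).
have num_inj : injective num.
  by move=> s t /(congr1 val) st; apply/enum_rank_inj/val_inj.
have [rep repP] := representative_exists partC transT.
(* The summand ['I_4] supplies isolated vertices: [inr i] is the root of colour [i] when no element
   of [T] has the number [i]. *)
pose e : rel (V + 'I_4) := fun x y =>
  if x is inl a then if y is inl b then adj G a b else false else false.
pose c (x : V + 'I_4) := match x with inl v => num (rep v) | inr i => i end.
pose r i : V + 'I_4 := if [pick s | num s == i] is Some s then inl (val s) else inr i.
pose D : rel 'I_4 := fun i j =>
  [exists s, exists t, [&& num s == i, num t == j & adj H s t]].
have e_sym : symmetric e by move=> [a|i] [b|j] //=; apply: adj_sym.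
have e_irr : irreflexive e by move=> [a|i] //=; apply: adj_irrefl.
have D_sym : symmetric D.
  by move=> i j; apply/existsP/existsP=> -[s /existsP[t /and3P[Es Et st]]];
    exists t; apply/existsP; exists s; rewrite Es Et adj_sym.
have rE s : r (num s) = inl (val s).
  rewrite /r; case: pickP => [t /eqP/num_inj->//|/(_ s)]; by rewrite eqxx.
have rep_class A s v : A \in C -> val s \in A -> v \in A -> rep v = s.
  move=> AC sA vA; apply: val_inj.
  exact: transversal_uniq transT _ _ _ AC (valP _) (valP s) (repP A v AC vA) sA.
have cr i : c (r i) = i.
  rewrite /r; case: pickP => [s /eqP <-|] //=; congr num.
  have sC : pblock C (val s) \in C by rewrite pblock_mem // (cover_partition partC) inE.
  have sP : val s \in pblock C (val s) by rewrite mem_pblock (cover_partition partC) inE.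
  exact: (rep_class _ _ _ sC sP sP).
have lk i j : D i j -> connect (within e (two_colored c i j)) (r i) (r j).
  case/existsP=> s /existsP[t /and3P[/eqP<- /eqP<- /HR st]]; rewrite !rE.
  have [A [B [AC BC sA tB con]]] := routing_adj_connect transT st.
  apply: (connect_homo (f := inl)) con => a b /and3P[aAB bAB ab].
  have col v : v \in A :|: B -> inl v \in two_colored c (num s) (num t).
    rewrite !inE /= => /orP[vA|vB]; first by rewrite (rep_class A s) ?eqxx.
    by rewrite (rep_class B t) ?eqxx ?orbT.
  by apply: connect1; rewrite /within /= !col.
have [B [rB disB cB tB]] := demanded_model e_sym e_irr D_sym cr lk.
exists (fun s => [set v | inl v \in B (num s)]); split=> [s t st|s|s x y|s t st].
- apply: disjoint_in => v; rewrite !inE => vs.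
  by rewrite (disjointFr (disB (num s) (num t) _) vs) // (inj_eq num_inj).
- by rewrite inE -rE.
(* [g] forgets the padding; its value [x] on [inr] is a dummy, as no edge of [e] meets a padding
   vertex. *)
- rewrite !inE => xB yB; pose g (z : V + 'I_4) := if z is inl v then v else x.
  rewrite -[x]/(g (inl x)) -[y]/(g (inl y)).
  apply: connect_homo (cB _ _ _ xB yB) => -[a|i] [b|j] /and3P[aB bB //= ab].
  by apply: connect1; rewrite /induced /= !inE aB bB.
have st' : s != t by apply: contraTneq st => ->; rewrite adj_irrefl.
have Dst : D (num s) (num t).
  by apply/existsP; exists s; apply/existsP; exists t; rewrite !eqxx.
have := tB (num s) (num t); rewrite (inj_eq num_inj) => /(_ st' Dst).
case/touchP=> -[a|i] [[b|j]] [aB bB //= ab].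
by exists a, b; rewrite !inE.
Qed.
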